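(* (i) Let $0<\underline{x}<\overline{x}$ and $0<\underline{y}<\overline{y}$ be real numbers, and let $$\overline{\mathcal{S}}_2=\{(x,z_1,z_2)\in\mathbb{R}^3 : \underline{x}\le x\le \overline{x},\ z_1^2\le x z_2,\ x+\underline{y}\,\overline{y}\,z_2\le(\underline{y}+\overline{y})z_1\},$$ $$\mathcal{S}_3=\{(x,z_1,z_2)\in\mathbb{R}^3 : \underline{x}\le x\le\overline{x},\ z_2\ge z_1^2/x,\ z_1\ge x/\overline{y},\ z_2\le x/\underline{y}^2\}.$$ Then $\overline{\mathcal{S}}_2\subsetneq\mathcal{S}_3$. (ii) For the optimization problems SDR1, SDR2, TCR1, TCR2 defined in the context, SDR2 is stronger than SDR1 and TCR2 is stronger than TCR1. That is, every feasible point of SDR2 is feasible for SDR1 and every feasible point of TCR2 is feasible for TCR1; consequently the optimal value (infimum) of SDR2 is at least that of SDR1, and the optimal value of TCR2 is at least that of TCR1.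
   Context: A power network consists of a set of buses $\mathcal{N}=\{1,\dots,n\}$ and a set of branches $\mathcal{L}\subseteq\mathcal{N}\times\mathcal{N}$; a branch $\ell=(k,m)$ has from-end $k$ and to-end $m$. $\mathcal{U}\subseteq\mathcal{N}$ is the set of buses with a shunt element, $\mathcal{T}\subseteq\mathcal{L}$ the set of branches with tap changers, $\mathcal{G}=\bigcup_{k\in\mathcal{N}}\mathcal{G}_k$ the set of generators, with $\mathcal{G}_k$ those connected to bus $k$. Data: real demands $p_{Dk},q_{Dk}$; real shunt parameters $g'_k,b'_k$ ($k\in\mathcal{U}$); complex series admittances $y_\ell$ and real shunt susceptances $b'_\ell$ ($\ell\in\mathcal{L}$); real generator bounds $\underline{p}_{Gg},\overline{p}_{Gg},\underline{q}_{Gg},\overline{q}_{Gg}$; line limits $\overline{s}_\ell$; voltage bounds $\underline{v}_k,\overline{v}_k$ with $\underline{v}_k>0$; tap ratio bounds $0<\underline{t}_\ell<\overline{t}_\ell$ ($\ell\in\mathcal{T}$). $\mathrm{j}$ is the imaginary unit, $^*$ complex conjugation, $^H$ conjugate transpose, $\succeq0$ means Hermitian positive semidefinite, and $\mathbb{H}^n$ is the set of $n\times n$ Hermitian matrices. Variables common to all four problems: $\xi\in\mathbb{R}^{|\mathcal{U}|}$, $p_G,q_G\in\mathbb{R}^{|\mathcal{G}|}$, $p_f,q_f,p_t,q_t\in\mathbb{R}^{|\mathcal{L}|}$, $V\in\mathbb{H}^{n}$, and $(W_{\ell\ell},W_{k\ell},W_{\ell m})\in\mathbb{R}\times\mathbb{R}\times\mathbb{C}$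 for each $\ell=(k,m)\in\mathcal{T}$. For $\ell=(k,m)\in\mathcal{T}$ put $$W_{\{\ell\}}=\begin{bmatrix}V_{kk}&W_{k\ell}&V_{km}\\ W_{k\ell}^*&W_{\ell\ell}&W_{\ell m}\\ V_{km}^*&W_{\ell m}^*&V_{mm}\end{bmatrix}.$$ Common constraints (C): - for $k\in\mathcal{U}$: $\sum_{g\in\mathcal{G}_k}p_{Gg}-p_{Dk}-g'_k\xi_k=\sum_{\ell=(k,m)\in\mathcal{L}}p_{f\ell}+\sum_{\ell=(m,k)\in\mathcal{L}}p_{t\ell}$, $\ \sum_{g\in\mathcal{G}_k}q_{Gg}-q_{Dk}+b'_k\xi_k=\sum_{\ell=(k,m)\in\mathcal{L}}q_{f\ell}+\sum_{\ell=(m,k)\in\mathcal{L}}q_{t\ell}$, and $0\le\xi_k\le V_{kk}$; - for $k\in\mathcal{N}\setminus\mathcal{U}$: the same two balance equations without the $\xi_k$ terms; - for $\ell=(k,m)\in\mathcal{T}$: $(-\mathrm{j}\tfrac{b'_\ell}{2}+y_\ell^* )W_{\ell\ell}-y_\ell^*W_{\ell m}=p_{f\ell}+\mathrm{j}q_{f\ell}$ and $-y_\ell^*W_{\ell m}^*+(-\mathrm{j}\tfrac{b'_\ell}{2}+y_\ell^* )V_{mm}=p_{t\ell}+\mathrm{j}q_{t\ell}$; - for $\ell=(k,m)\in\mathcal{L}\setminus\mathcal{T}$: $(-\mathrm{j}\tfrac{b'_\ell}{2}+y_\ell^* )V_{kk}-y_\ell^*V_{km}=p_{f\ell}+\mathrm{j}q_{f\ell}$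 and $-y_\ell^*V_{km}^*+(-\mathrm{j}\tfrac{b'_\ell}{2}+y_\ell^* )V_{mm}=p_{t\ell}+\mathrm{j}q_{t\ell}$; - $\underline{p}_{Gg}\le p_{Gg}\le\overline{p}_{Gg}$ and $\underline{q}_{Gg}\le q_{Gg}\le\overline{q}_{Gg}$ for $g\in\mathcal{G}$; $|p_{f\ell}+\mathrm{j}q_{f\ell}|\le\overline{s}_\ell$ and $|p_{t\ell}+\mathrm{j}q_{t\ell}|\le\overline{s}_\ell$ for $\ell\in\mathcal{L}$; $\underline{v}_k^2\le V_{kk}\le\overline{v}_k^2$ for $k\in\mathcal{N}$. All four problems minimize a convex objective function $f$ of the variables; the same $f$ is used in SDR1 and SDR2, and the same $f$ is used in TCR1 and TCR2. SDR1: subject to (C), $V\succeq0$, $W_{\{\ell\}}\succeq0$ for all $\ell\in\mathcal{T}$, and, for all $\ell=(k,m)\in\mathcal{T}$, $W_{k\ell}\ge V_{kk}/\overline{t}_\ell$ and $W_{\ell\ell}\le V_{kk}/\underline{t}_\ell^2$. SDR2: subject to (C), $V\succeq0$, $W_{\{\ell\}}\succeq0$ for all $\ell\in\mathcal{T}$, and $V_{kk}+\underline{t}_\ell\overline{t}_\ell W_{\ell\ell}\le(\underline{t}_\ell+\overline{t}_\ell)W_{k\ell}$ for all $\ell=(k,m)\in\mathcal{T}$. TCR1 and TCR2 have the additional variables $v\in\mathbb{C}^{n}$ and $w\in\mathbb{C}^{|\mathcal{T}|}$. Let (T) denote the constraints $$\begin{bmatrix}1&v_k^*&v_m^*\\ v_k&V_{kk}&V_{km}\\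 v_m&V_{km}^*&V_{mm}\end{bmatrix}\succeq0\ \ \forall\ell=(k,m)\in\mathcal{L}\setminus\mathcal{T},\qquad \begin{bmatrix}1&w_{\{\ell\}}^H\\ w_{\{\ell\}}&W_{\{\ell\}}\end{bmatrix}\succeq0\ \ \forall\ell=(k,m)\in\mathcal{T},$$ where $w_{\{\ell\}}^H=(v_k^*,w_\ell^*,v_m^* )$, together with $\operatorname{Re}(v_1)\ge\dfrac{V_{11}+\underline{v}_1\overline{v}_1}{\underline{v}_1+\overline{v}_1}$ and $\operatorname{Im}(v_1)=0$. TCR1: subject to (C), (T), and, for all $\ell=(k,m)\in\mathcal{T}$, $V_{kk}/\overline{t}_\ell\le W_{k\ell}\le V_{kk}/\underline{t}_\ell$ and $V_{kk}/\overline{t}_\ell^2\le W_{\ell\ell}\le V_{kk}/\underline{t}_\ell^2$. TCR2: subject to (C), (T), and $V_{kk}+\underline{t}_\ell\overline{t}_\ell W_{\ell\ell}\le(\underline{t}_\ell+\overline{t}_\ell)W_{k\ell}$ for all $\ell=(k,m)\in\mathcal{T}$. *)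

(* Defs.v *)
From HB Require Import structures.
From mathcomp Require Import all_boot all_order all_algebra.
From mathcomp Require Import complex.
From mathcomp Require Import boolp classical_sets reals ereal convex.

Set Implicit Arguments.
Unset Strict Implicit.
Unset Printing Implicit Defensive.

Import Order.TTheory GRing.Theory Num.Theory.

Local Open Scope classical_set_scope.
Local Open Scope sesquilinear_scope.
Local Open Scope ring_scope.
Local Open Scope complex_scope.

Definition psdmx (R : rcfType) (n : nat) (A : 'M[R[i]]_n) : Prop :=
  A \is hermsymmx /\
  forall x : 'cV[R[i]]_n, 0 <= (x ^t* *m A *m x) ord0 ord0.

Definition mx_of_rows (T : nmodType) (n : nat) (s : seq (seq T)) : 'M[T]_n :=
  \matrix_(i < n, j < n) nth 0 (nth [::] s i) j.

Definition S2bar (R : realType) (xl xu yl yu : R) : set (R * R * R) :=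
  [set u | let: (x, z1, z2) := u in
    [/\ xl <= x <= xu, z1 ^+ 2 <= x * z2 &
        x + yl * yu * z2 <= (yl + yu) * z1]].

Definition S3 (R : realType) (xl xu yl yu : R) : set (R * R * R) :=
  [set u | let: (x, z1, z2) := u in
    [/\ xl <= x <= xu, z2 >= z1 ^+ 2 / x, z1 >= x / yu & z2 <= x / yl ^+ 2]].

(* The [nbus_pred.+1] buses are numbered from 0; there is at least one since
   TCR1 and TCR2 refer to the first one, [ord0]. A branch is its pair
   (from-end, to-end). In the notation of the literature, [gsh] and [bsh] are
   the shunt parameters g'_k and b'_k, [adm] and [bch] the series admittance y_l
   and the shunt susceptance b'_l of a branch. *)
Record network (R : realType) := Network {
  nbus_pred : nat ;
  bus := 'I_nbus_pred.+1 ;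
  branches : {set bus * bus} ;
  branch := {e : bus * bus | e \in branches} ;
  shunts : {set bus} ;
  shunt := {k : bus | k \in shunts} ;
  taps : {set branch} ;
  tap := {l : branch | l \in taps} ;
  gen : finType ;
  gens : bus -> {set gen} ;
  gens_cover : (\bigcup_k gens k)%SET = [set: gen]%SET ;
  pD : bus -> R ;
  qD : bus -> R ;
  gsh : shunt -> R ;
  bsh : shunt -> R ;
  adm : branch -> R[i] ;
  bch : branch -> R ;
  pGmin : gen -> R ;
  pGmax : gen -> R ;
  qGmin : gen -> R ;
  qGmax : gen -> R ;
  smax : branch -> R ;
  vmin : bus -> R ;
  vmax : bus -> R ;
  vmin_gt0 : forall k, 0 < vmin k ;
  tmin : tap -> R ;
  tmax : tap -> R ;
  tmin_gt0 : forall l, 0 < tmin l ;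
  tmin_lt_tmax : forall l, tmin l < tmax l
}.

Section Problems.
Variables (R : realType) (N : network R).

Local Notation bus := (bus N).
Local Notation branch := (branch N).
Local Notation shunt := (shunt N).
Local Notation tap := (tap N).
Local Notation gen := (gen N).

Definition from_end (l : branch) : bus := (val l).1.
Definition to_end (l : branch) : bus := (val l).2.

(* The real vector space of the variables
   (xi, (p_G, q_G), (p_f, q_f, p_t, q_t), V, (W_ll, W_kl, W_lm));
   [Rcomplex R] is [R[i]] seen as a vector space over [R]. The entries of [V]
   are stored as a finite function because ['M[Rcomplex R]_n] is no
   [lmodType R]. All square matrices are allowed here; [sdr_domain] and
   [tcr_domain] restrict [V] to the Hermitian ones. *)
Definition sdr_space : lmodType R :=
  ({ffun shunt -> R^o}
   * ({ffun gen -> R^o} * {ffun gen -> R^o})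
   * ({ffun branch -> R^o} * {ffun branch -> R^o}
      * {ffun branch -> R^o} * {ffun branch -> R^o})
   * {ffun bus * bus -> Rcomplex R}
   * ({ffun tap -> R^o} * {ffun tap -> R^o} * {ffun tap -> Rcomplex R}))%type.

Definition tcr_space : lmodType R :=
  (sdr_space * ({ffun bus -> Rcomplex R} * {ffun tap -> Rcomplex R}))%type.

Section CommonConstraints.
Variable X : sdr_space.

Definition xi (k : shunt) : R := X.1.1.1.1 k.
Definition pG (g : gen) : R := X.1.1.1.2.1 g.
Definition qG (g : gen) : R := X.1.1.1.2.2 g.
Definition pf (l : branch) : R := X.1.1.2.1.1.1 l.
Definition qf (l : branch) : R := X.1.1.2.1.1.2 l.
Definition pt (l : branch) : R := X.1.1.2.1.2 l.
Definition qt (l : branch) : R := X.1.1.2.2 l.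
Definition V : 'M[R[i]]_((nbus_pred N).+1) :=
  \matrix_(k, m) X.1.2 (k, m).
Definition Wll (l : tap) : R := X.2.1.1 l.
Definition Wkl (l : tap) : R := X.2.1.2 l.
Definition Wlm (l : tap) : R[i] := X.2.2 l.

(* [V k k] as a real number: [V] is Hermitian. *)
Definition Vd (k : bus) : R := complex.Re (V k k).

Definition Wmx (l : tap) : 'M[R[i]]_3 :=
  let k := from_end (val l) in let m := to_end (val l) in
  mx_of_rows 3
    [:: [:: V k k;        (Wkl l)%:C;   V k m];
        [:: ((Wkl l)%:C)^*; (Wll l)%:C;   Wlm l];
        [:: (V k m)^*;    (Wlm l)^*;    V m m]].

Definition gen_p (k : bus) : R := \sum_(g in gens k) pG g.
Definition gen_q (k : bus) : R := \sum_(g in gens k) qG g.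
Definition out_p (k : bus) : R :=
  \sum_(l : branch | from_end l == k) pf l
  + \sum_(l : branch | to_end l == k) pt l.
Definition out_q (k : bus) : R :=
  \sum_(l : branch | from_end l == k) qf l
  + \sum_(l : branch | to_end l == k) qt l.

Definition balance : Prop :=
  (forall k : shunt,
    [/\ gen_p (val k) - pD (val k) - gsh k * xi k = out_p (val k),
        gen_q (val k) - qD (val k) + bsh k * xi k = out_q (val k) &
        0 <= xi k <= Vd (val k)]) /\
  (forall k : bus, k \notin shunts N ->
    gen_p k - pD k = out_p k /\ gen_q k - qD k = out_q k).

Definition self_adm (l : branch) : R[i] := - 'i * (bch l / 2)%:C + (adm l)^*.

Definition flow_tap : Prop := forall l : tap,
  let e := val l in let m := to_end e in
  self_adm e * (Wll l)%:C - (adm e)^* * Wlm l = pf e +i* qf e /\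
  - (adm e)^* * (Wlm l)^* + self_adm e * V m m = pt e +i* qt e.

Definition flow_notap : Prop := forall l : branch, l \notin taps N ->
  let k := from_end l in let m := to_end l in
  self_adm l * V k k - (adm l)^* * V k m = pf l +i* qf l /\
  - (adm l)^* * (V k m)^* + self_adm l * V m m = pt l +i* qt l.

Definition bounds : Prop :=
  [/\ forall g : gen, pGmin g <= pG g <= pGmax g,
      forall g : gen, qGmin g <= qG g <= qGmax g,
      forall l : branch, `|pf l +i* qf l| <= (smax l)%:C,
      forall l : branch, `|pt l +i* qt l| <= (smax l)%:C &
      forall k : bus, vmin k ^+ 2 <= Vd k <= vmax k ^+ 2].

Definition common_constraints : Prop :=
  [/\ balance, flow_tap, flow_notap & bounds].

Definition sdr_psd : Prop := psdmx V /\ forall l : tap, psdmx (Wmx l).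

Definition sdr1_tap : Prop := forall l : tap,
  Wkl l >= Vd (from_end (val l)) / tmax l /\
  Wll l <= Vd (from_end (val l)) / tmin l ^+ 2.

Definition tcr1_tap : Prop := forall l : tap,
  let Vkk := Vd (from_end (val l)) in
  Vkk / tmax l <= Wkl l <= Vkk / tmin l /\
  Vkk / tmax l ^+ 2 <= Wll l <= Vkk / tmin l ^+ 2.

Definition hull_tap : Prop := forall l : tap,
  Vd (from_end (val l)) + tmin l * tmax l * Wll l
    <= (tmin l + tmax l) * Wkl l.

End CommonConstraints.

Section TightConstraints.
Variable Z : tcr_space.

Definition v (k : bus) : R[i] := Z.2.1 k.
Definition w (l : tap) : R[i] := Z.2.2 l.

Definition wvec (l : tap) : 'cV[R[i]]_3 :=
  \col_i nth 0 [:: v (from_end (val l)); w l; v (to_end (val l))] i.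

Definition tcr_notap : Prop := forall l : branch, l \notin taps N ->
  let k := from_end l in let m := to_end l in
  psdmx (mx_of_rows 3
    [:: [:: 1;   (v k)^*;        (v m)^*];
        [:: v k; V Z.1 k k;      V Z.1 k m];
        [:: v m; (V Z.1 k m)^*;  V Z.1 m m]]).

Definition tcr_tap : Prop := forall l : tap,
  psdmx (block_mx (1%:M : 'M_1) (wvec l ^t*) (wvec l) (Wmx Z.1 l)).

Definition tcr_ref : Prop :=
  complex.Re (v ord0) >=
    (Vd Z.1 ord0 + vmin (ord0 : bus) * vmax (ord0 : bus))
      / (vmin (ord0 : bus) + vmax (ord0 : bus)) /\
  complex.Im (v ord0) = 0.

Definition tcr_constraints : Prop := [/\ tcr_notap, tcr_tap & tcr_ref].

End TightConstraints.

Definition sdr_domain : set sdr_space := [set X | V X \is hermsymmx].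
Definition tcr_domain : set tcr_space := [set Z | sdr_domain Z.1].

Definition SDR1 : set sdr_space :=
  [set X | [/\ sdr_domain X, common_constraints X, sdr_psd X & sdr1_tap X]].

Definition SDR2 : set sdr_space :=
  [set X | [/\ sdr_domain X, common_constraints X, sdr_psd X & hull_tap X]].

Definition TCR1 : set tcr_space :=
  [set Z | [/\ tcr_domain Z, common_constraints Z.1, tcr_constraints Z &
               tcr1_tap Z.1]].

Definition TCR2 : set tcr_space :=
  [set Z | [/\ tcr_domain Z, common_constraints Z.1, tcr_constraints Z &
               hull_tap Z.1]].

End Problems.

Arguments sdr_domain {R} N.
Arguments tcr_domain {R} N.
Arguments SDR1 {R} N.
Arguments SDR2 {R} N.
Arguments TCR1 {R} N.
Arguments TCR2 {R} N.

(* [+oo] for an infeasible problem, [-oo] for an unbounded one. *)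
Definition optimal_value (R : realType) (T : Type) (f : T -> R)
    (feasible : set T) : \bar R :=
  ereal_inf [set (f X)%:E | X in feasible].

(* Main.v *)
(** The leading 2x2 minor of [W_{l}] gives [W_kl ^ 2 <= V_kk * W_ll], and
    [V_kk >= vmin_k ^ 2 > 0]. So the two feasible-set inclusions reduce, tap by
    tap, to the three-variable inclusion with
    [(x, z1, z2) = (V_kk, W_kl, W_ll)]. *)

Require Import Defs.
From mathcomp Require Import all_boot all_order all_algebra.
From mathcomp Require Import complex.
From mathcomp Require Import boolp classical_sets reals ereal convex.
From mathcomp Require Import ring lra.
Local Open Scope classical_set_scope.
Local Open Scope ring_scope.

Import Order.TTheory GRing.Theory Num.Theory.

Set Implicit Arguments.
Unset Strict Implicit.
Unset Printing Implicit Defensive.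

Section PositiveSemidefinite.
Local Open Scope sesquilinear_scope.

Lemma delta_form (C : numClosedFieldType) (n : nat) (A : 'M[C]_n) (i j : 'I_n) :
  (delta_mx i ord0 : 'cV_n) ^t* *m A *m (delta_mx j ord0 : 'cV_n)
    = (A i j)%:M.
Proof.
rewrite trmx_delta map_delta_mx -rowE -colE.
by apply/matrixP=> k l; rewrite !ord1 !mxE mulr1n.
Qed.

Lemma psdmx_diag_ge0 (R : rcfType) (n : nat) (A : 'M[R[i]]_n) (i : 'I_n) :
  psdmx A -> 0 <= A i i.
Proof.
by case=> _ /(_ (delta_mx i ord0)); rewrite delta_form !mxE eqxx mulr1n.
Qed.

(** At a suitable test vector the form equals [A i i] times the 2x2 minor; the positive factor then
    cancels. *)
Lemma psdmx_minor2 (R : rcfType) (n : nat) (A : 'M[R[i]]_n) (i j : 'I_n) :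
  psdmx A -> 0 < A i i -> `|A i j| ^+ 2 <= A i i * A j j.
Proof.
case=> /is_hermitianmxP; rewrite expr0 scale1r => Aherm Apsd Aii_gt0.
have Aji : A j i = (A i j)^* by rewrite [in LHS]Aherm !mxE.
have Aii : (A i i)^* = A i i by apply/CrealP/gtr0_real.
(* The coefficients make entry [i] of [A *m x] vanish, so only the [j] coordinate contributes to the
   form. *)
pose x : 'cV_n := - A i j *: delta_mx i ord0 + A i i *: delta_mx j ord0.
have -> : `|A i j| ^+ 2 = A i j * (A i j)^* by rewrite normCK.
have := Apsd x.
have -> : x ^t* = - (A i j)^* *: (delta_mx i ord0 : 'cV_n) ^t*
                  + A i i *: (delta_mx j ord0 : 'cV_n) ^t*.
  by rewrite /x linearD !linearZ /= map_mxD !map_mxZ rmorphN /= -{2}Aii.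
rewrite /x !(mulmxDl, mulmxDr) -!(scalemxAl, scalemxAr) !delta_form.
rewrite !mxE eqxx !mulr1n Aji.
set a := A i i in Aii_gt0 *; set b := A i j; set c := A j j.
rewrite (_ : _ + _ = a * (a * c - b * b^*)); last by ring.
by rewrite pmulr_rge0 // subr_ge0.
Qed.

(** Test vectors padded with a zero first block see only the lower right block. This recovers [Wmx]
    from the bordered matrix of [tcr_tap]. *)
Lemma psdmx_drsubmx (R : rcfType) (m n : nat) (A : 'M[R[i]]_(m + n)) :
  psdmx A -> psdmx (drsubmx A).
Proof.
case=> /is_hermitianmxP; rewrite expr0 scale1r => Aherm Apsd; split.
  apply/is_hermitianmxP; rewrite expr0 scale1r.
  by apply/matrixP=> i j; rewrite !mxE [in LHS]Aherm !mxE.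
move=> x; have := Apsd (col_mx 0 x).
rewrite tr_col_mx map_row_mx -[A in X in X -> _]submxK mul_row_block.
by rewrite mul_row_col !trmx0 !map_mx0 !mul0mx !mulmx0 !add0r.
Qed.

End PositiveSemidefinite.

Section TapInterval.
Variables (R : realFieldType) (a b x z1 z2 : R).
Hypotheses (a_gt0 : 0 < a) (ab : a < b) (x_gt0 : 0 < x).
Hypotheses (cone : z1 ^+ 2 <= x * z2) (cut : x + a * b * z2 <= (a + b) * z1).

(* Multiplying [cut] by [x] and using [cone] gives
   [(x - a * z1) * (x - b * z1) <= 0]. *)
Lemma cut_z1_bounds : x / b <= z1 <= x / a.
Proof.
have b_gt0 : 0 < b by exact: lt_trans ab.
have prod_le0 : (x - a * z1) * (x - b * z1) <= 0.
  have := ler_wpM2l (ltW x_gt0) cut.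
  have := ler_wpM2l (ltW (mulr_gt0 a_gt0 b_gt0)) cone.
  nra.
have z2_ge0 : 0 <= z2.
  by rewrite -(pmulr_rge0 _ x_gt0); apply: le_trans cone; exact: sqr_ge0.
have z1_gt0 : 0 < z1.
  rewrite -(pmulr_rgt0 z1 (addr_gt0 a_gt0 b_gt0)); apply: lt_le_trans cut.
  by rewrite ltr_pwDl // !mulr_ge0 // ltW.
have az_lt_bz : a * z1 < b * z1 by rewrite ltr_pM2r.
rewrite ler_pdivrMr // ler_pdivlMr // (mulrC z1 b) (mulrC z1 a).
(* As [a * z1 < b * z1], having [x] above [b * z1] makes both factors of [prod_le0] positive, and
   [x] below [a * z1] makes both negative. *)
apply/andP; split; rewrite leNgt; apply/negP => bad;
  move: prod_le0; apply/negP; rewrite -ltNge.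
  by rewrite mulr_gt0 // subr_gt0 // (lt_trans az_lt_bz).
by rewrite nmulr_rgt0 subr_lt0 // (lt_trans bad).
Qed.

(** Each side combines one bound on [z1] with one hypothesis: [cone] gives
    [x * z2 >= z1 ^+ 2 >= (x / b) ^+ 2], and [cut] gives [a * b * z2 <= (a + b) * (x / a) - x]. *)
Lemma cut_z2_bounds : x / b ^+ 2 <= z2 <= x / a ^+ 2.
Proof.
have b_gt0 : 0 < b by exact: lt_trans ab.
have /andP[lo hi] := cut_z1_bounds.
apply/andP; split.
  rewrite -(ler_pM2l x_gt0); apply: le_trans cone.
  have -> : x * (x / b ^+ 2) = (x / b) ^+ 2 by rewrite expr_div_n expr2 mulrA.
  by rewrite ler_sqr // nnegrE ?(le_trans _ lo) // divr_ge0 // ltW.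
rewrite -(ler_pM2l (mulr_gt0 a_gt0 b_gt0)).
have -> : a * b * (x / a ^+ 2) = (a + b) * (x / a) - x.
  by field; rewrite gt_eqF.
rewrite lerBrDl; apply: le_trans cut _.
by rewrite ler_pM2l // addr_gt0.
Qed.

End TapInterval.

Lemma S2bar_proper_S3 (R : realType) (xl xu yl yu : R) :
  0 < xl -> xl < xu -> 0 < yl -> yl < yu ->
  S2bar xl xu yl yu `<` S3 xl xu yl yu.
Proof.
move=> xl_gt0 xl_lt yl_gt0 yl_lt; have yu_gt0 := lt_trans yl_gt0 yl_lt.
split=> [[[x z1] z2] [xb cone cut]|].
  have x_gt0 : 0 < x by case/andP: xb => + _; exact: lt_le_trans.
  have /andP[z1_ge _] := cut_z1_bounds yl_gt0 yl_lt x_gt0 cone cut.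
  have /andP[_ z2_le] := cut_z2_bounds yl_gt0 yl_lt x_gt0 cone cut.
  by split; rewrite // ler_pdivrMr // mulrC.
(* The corner of S3 where both linear bounds are tight violates the cut. *)
move=> /(_ (xl, xl / yu, xl / yl ^+ 2))[].
  split; rewrite ?lexx ?(ltW xl_lt) //.
  have -> : (xl / yu) ^+ 2 / xl = xl / yu ^+ 2.
    by field; rewrite !gt_eqF.
  rewrite ler_pM2l // lef_pV2 ?posrE ?exprn_gt0 //.
  by rewrite ler_sqr ?nnegrE ltW.
move=> _ _; apply/negP; rewrite -ltNge.
have -> : (yl + yu) * (xl / yu) = xl + xl * (yl / yu).
  by field; rewrite gt_eqF.
have -> : xl + yl * yu * (xl / yl ^+ 2) = xl + xl * (yu / yl).
  by field; rewrite gt_eqF.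
rewrite ltrD2l ltr_pM2l //.
(* The cut would need [yu / yl <= yl / yu], but 1 separates the two ratios the other way. *)
apply: (@lt_trans _ _ 1); first by rewrite ltr_pdivrMr // mul1r.
by rewrite ltr_pdivlMr // mul1r.
Qed.

Section Relaxations.
Local Open Scope complex_scope.
Variables (R : realType) (N : network R).

Lemma Wmx_cone (X : sdr_space N) (l : tap N) :
  0 < Vd X (from_end (val l)) -> psdmx (Wmx X l) ->
  Wkl X l ^+ 2 <= Vd X (from_end (val l)) * Wll X l.
Proof.
rewrite /Vd; set k := from_end (val l) => Vkk_gt0 psdW.
have := psdmx_minor2 (i := inord 0) (inord 1) psdW.
have := psdmx_diag_ge0 (inord 0) psdW.
rewrite !mxE !inordK //= -/k.
(* Nonnegativity in [R[i]] forces a zero imaginary part, so the diagonal entry is its real part [Vd]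
   and the minor inequality descends to [R]. *)
rewrite [_ <= _]lecE /= => /andP[/eqP im0 _].
move: Vkk_gt0; rewrite !mxE.
case: (X.1.2 (k, k)) im0 => re im /= -> re_gt0.
rewrite ltcR => /(_ re_gt0).
rewrite -[re +i* 0]/(re%:C) -rmorphM normc_def /= expr0n addr0 sqrtr_sqr.
by rewrite -rmorphXn /= real_normK ?num_real // lecR.

Qed.

(** Serves both inclusions: [sdr1_tap] is two of these four bounds, and positivity is asked only of
    the matrices [Wmx X l], which both kinds of relaxation provide. *)
Lemma hull_tap_tcr1_tap (X : sdr_space N) :
  common_constraints X -> (forall l, psdmx (Wmx X l)) ->
  hull_tap X -> tcr1_tap X.
Proof.
move=> [_ _ _ [_ _ _ _ Vb]] psdW hull l /=.
have Vkk_gt0 : 0 < Vd X (from_end (val l)).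
  have /andP[+ _] := Vb (from_end (val l)).
  by apply: lt_le_trans; rewrite exprn_gt0 // vmin_gt0.
have cone := Wmx_cone Vkk_gt0 (psdW l).
have tmin0 := tmin_gt0 l; have tminmax := tmin_lt_tmax l.
by split; [apply: cut_z1_bounds cone _|apply: cut_z2_bounds cone _].
Qed.

Lemma SDR2_sub_SDR1 : SDR2 N `<=` SDR1 N.
Proof.
move=> X [dom comm psdX hull]; split=> // l.
by have [/andP[lo _] /andP[_ hi]] := hull_tap_tcr1_tap comm psdX.2 hull l.
Qed.

Lemma TCR2_sub_TCR1 : TCR2 N `<=` TCR1 N.
Proof.
move=> Z [dom comm tight hull]; split=> //.
apply: hull_tap_tcr1_tap => // l.
case: tight => _ /(_ l) /psdmx_drsubmx + _.
by rewrite block_mxKdr.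
Qed.

End Relaxations.

Lemma le_optimal_value (R : realType) (T : Type) (f : T -> R) (A B : set T) :
  A `<=` B -> (optimal_value f B <= optimal_value f A)%E.
Proof. by move=> AB; apply/ereal_inf_le_tmp/image_subset. Qed.

Theorem mainTheorem2 (R : realType) :
  (forall xl xu yl yu : R, 0 < xl -> xl < xu -> 0 < yl -> yl < yu ->
    S2bar xl xu yl yu `<` S3 xl xu yl yu)
  /\
  (forall N : network R,
    [/\ SDR2 N `<=` SDR1 N,
        TCR2 N `<=` TCR1 N,
        forall f : sdr_space N -> R, convex_function (sdr_domain N) f ->
          (optimal_value f (SDR1 N) <= optimal_value f (SDR2 N))%E &
        forall f : tcr_space N -> R, convex_function (tcr_domain N) f ->
          (optimal_value f (TCR1 N) <= optimal_value f (TCR2 N))%E]).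
Proof.
split=> [xl xu yl yu|N]; first exact: S2bar_proper_S3.
split=> [||f _|f _]; [exact: SDR2_sub_SDR1|exact: TCR2_sub_TCR1| |].
  exact/le_optimal_value/SDR2_sub_SDR1.
exact/le_optimal_value/TCR2_sub_TCR1.
Qed.
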